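(* A connected graph $G$ is a $3$-leaf power if and only if (1) its split tree $ST(G)=(T,\mathcal{F})$ is a clique-star tree; (2) the set of star nodes of $T$ induces a connected subtree of $T$; and (3) for every star node $u$, the tree-edge $e$ with $\rho_u(e)$ the centre of $G_u$ has as its other endpoint a leaf or a clique node.
   Context: A graph $G$ is a $k$-leaf power if there is a tree whose leaf set is $V(G)$ such that $xy\in E(G)$ iff the distance in the tree between $x$ and $y$ is at most $k$. A graph-labelled tree $(T,\mathcal{F})$: a tree $T$ whose internal vertices (nodes) $v$ of degree $k$ carry a graph $G_v$ on $k$ marker vertices and a bijection $\rho_v$ from tree-edges at $v$ to $V(G_v)$; for a leaf $l$, a node or leaf $u\ne l$ is $l$-accessible if for consecutive tree-edges $e=wv,e'=vw'$ on the $l,u$-path, $\rho_v(e)\rho_v(e')\in E(G_v)$; the accessibility graph has the leaves as vertices, $x,y$ adjacent iff $y$ is $x$-accessible. A split of $H$ is a bipartition $(V_1,V_2)$ of $V(H)$, $|V_i|\ge 2$, such that every vertex of $V_2$ with a neighbour in $V_1$ is adjacent to every vertex of $V_1$ with a neighbour in $V_2$; prime = no split; degenerate = clique or star ($K_{1,m}$, centre = universal vertex, others extremities). Reduced: all nodes of degree $\ge3$, no two adjacent clique nodes, no adjacent star nodes $u,v$ with $\rho_u(uv)$ the centre of $G_u$ and $\rho_v(uv)$ an extremity of $G_v$. The split tree $ST(G)$ is the unique reduced graph-labelled tree with accessibility graph $G$ whose labels are prime or degenerate. A clique-star tree has all labels cliques or stars; clique/star nodes are nodes with clique/star labels. *)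

(* Defs.v *)
From mathcomp Require Import all_boot.
Set Implicit Arguments.
Unset Strict Implicit.
Unset Printing Implicit Defensive.

Record sgraph := SGraph {
  svertex :> finType;
  sedge : rel svertex;
  sedge_sym : symmetric sedge;
  sedge_irrefl : irreflexive sedge
}.
Arguments sedge {s} : rename.
Notation "x -- y" := (sedge x y) (at level 30).

Section Graphs.
Variable H : sgraph.
Implicit Types (x y c : H) (S : {set H}).

(* The subgraph induced by S is connected; this holds for S = set0. *)
Definition connected_set S : bool :=
  [forall x in S, forall y in S,
     connect [rel a b | [&& a \in S, b \in S & a -- b]] x y].

Definition connected_graph : bool :=
  (0 < #|H|) && connected_set [set: H].

Definition acyclic : Prop := forall s : seq H, ucycle sedge s -> size s <= 2.

Definition is_tree : Prop := connected_graph /\ acyclic.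

Definition degree x : nat := #|[pred y | x -- y]|.

(* The unique vertex of the one-vertex tree counts as a leaf. *)
Definition is_leaf x : bool := degree x <= 1.
Definition is_node x : bool := ~~ is_leaf x.

(* The length of a shortest walk from x to y, or #|H| if there is none. *)
Definition dist x y : nat :=
  find (fun n => [exists p : n.-tuple H, path sedge x p && (last x p == y)])
       (iota 0 #|H|).

(* (S, ~: S) is a split. *)
Definition is_split S : bool :=
  [&& 2 <= #|S|, 2 <= #|~: S| &
      [forall x in S, forall y in ~: S,
         [exists y' in ~: S, x -- y'] && [exists x' in S, x' -- y]
           ==> (x -- y)]].

Definition is_prime : bool := [forall S : {set H}, ~~ is_split S].

Definition is_clique : bool := [forall x : H, forall y : H, (x != y) ==> (x -- y)].

Definition is_star : bool :=
  (2 <= #|H|) &&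
  [exists c : H, forall x : H, forall y : H,
     (x -- y) == ((x != y) && ((x == c) || (y == c)))].

Definition is_centre c : bool :=
  is_star && [forall y : H, (y != c) ==> (c -- y)].

Definition is_extremity c : bool := is_star && ~~ is_centre c.

Definition is_degenerate : bool := is_clique || is_star.

End Graphs.

(* f identifies the vertices of G with the leaves of T. *)
Definition leaf_bijection (G T : sgraph) (f : G -> T) : Prop :=
  injective f /\ forall v : T, is_leaf v = (v \in codom f).

Definition leaf_power (k : nat) (G : sgraph) : Prop :=
  exists (T : sgraph) (f : G -> T),
    [/\ is_tree T,
        leaf_bijection f &
        forall x y : G, x != y -> (x -- y) = (dist (f x) (f y) <= k)].

(* A tree-edge vw at v is represented by its other endpoint w, so rho v w is
   the marker vertex rho_v(vw). The values glt_label v for a leaf v, and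
   rho v w for w not adjacent to v, are irrelevant. *)
Record glt := GLT {
  glt_tree :> sgraph;
  glt_label : glt_tree -> sgraph;
  rho : forall v : glt_tree, glt_tree -> glt_label v;
  glt_is_tree : is_tree glt_tree;
  rho_inj : forall v : glt_tree, is_node v ->
    {in [pred w | v -- w] &, injective (rho v)};
  rho_surj : forall v : glt_tree, is_node v ->
    forall m : glt_label v, exists2 w, v -- w & rho v w = m
}.
Arguments glt_label {g} v : rename.
Arguments rho {g} v w : rename.

Section GraphLabelledTrees.
Variable T : glt.
Implicit Types (u v w l : T).

Definition accessible l u : Prop :=
  u != l /\
  exists p : seq T,
    [/\ path sedge l p, uniq (l :: p), last l p = u &
        forall w v w', infix [:: w; v; w'] (l :: p) -> rho v w -- rho v w'].

Definition clique_node v : bool := is_node v && is_clique (glt_label v).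
Definition star_node v : bool := is_node v && is_star (glt_label v).

Definition reduced : Prop :=
  [/\ forall v, is_node v -> 3 <= degree v,
      forall u v, u -- v -> ~~ (clique_node u && clique_node v) &
      forall u v, u -- v -> star_node u -> star_node v ->
        ~~ (is_centre (rho u v) && is_extremity (rho v u))].

Definition clique_star_tree : Prop :=
  forall v, is_node v -> is_clique (glt_label v) || is_star (glt_label v).

Definition star_nodes_connected : Prop :=
  connected_set [set v : T | star_node v].

Definition centres_towards_leaf_or_clique : Prop :=
  forall u w, star_node u -> u -- w -> is_centre (rho u w) ->
    is_leaf w \/ clique_node w.

End GraphLabelledTrees.

(* G is the accessibility graph of T, up to the naming of the leaves. *)
Definition accessibility_graph (T : glt) (G : sgraph) : Prop :=
  exists f : G -> T,
    leaf_bijection f /\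
    forall x y : G, x -- y <-> accessible (f x) (f y).

Definition is_split_tree (G : sgraph) (T : glt) : Prop :=
  [/\ reduced T,
      forall v : T, is_node v ->
        is_prime (glt_label v) \/ is_degenerate (glt_label v) &
      accessibility_graph T G].

(* Main.v *)
(** A graph is a 3-leaf power exactly when it is obtained from a forest [C] by
    blowing up vertices into cliques, i.e. there is a map [pi : G -> C] into an
    acyclic graph such that distinct vertices of [G] are adjacent iff their
    images are equal or adjacent: send a vertex to the neighbour of the
    corresponding leaf of a root.

    If [G] is such a blow-up, it contains no triangle whose vertices are
    pairwise not true twins and no induced 4-cycle, and every blow-up with at
    least four vertices has a split.  Since [G] is connected, every tree-edge
    leads to an accessible leaf, so the labels of the split tree are induced
    subgraphs of [G]; hence the prime ones have three vertices.  A clique node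
    between two star nodes yields a forbidden triangle, and two star nodes with
    facing centres yield a 4-cycle.

    Conversely, given the three conditions, [C] is the split tree itself: every
    leaf hangs, directly or through a clique node, on an edge [uw] of a unique
    star node [u]; it is sent to [u] if [uw] is at the centre of [u] and to [w]
    otherwise. *)

Require Import Defs.
From mathcomp Require Import all_boot.
Set Implicit Arguments.
Unset Strict Implicit.
Unset Printing Implicit Defensive.

(** * Neighbours of leaves and nodes *)

Lemma is_leaf_neighbour (H : sgraph) (v a b : H) :
  is_leaf v -> v -- a -> v -- b -> a = b.
Proof. by rewrite /is_leaf /degree => /card_le1_eqP h va vb; apply: h. Qed.

Lemma is_nodeP (H : sgraph) (v a b : H) : v -- a -> v -- b -> a != b -> is_node v.
Proof.
by move=> va vb; apply: contra_neqN => lv; apply: is_leaf_neighbour lv va vb.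
Qed.

Lemma is_node_neighbour (H : sgraph) (v a : H) :
  is_node v -> exists2 b, v -- b & b != a.
Proof.
rewrite /is_node /is_leaf /degree -ltnNge => /card_gt1P[b [c [vb vc bc]]].
have [eba|ba] := eqVneq b a; last by exists b.
by exists c => //; rewrite -eba eq_sym.
Qed.

Lemma neighbour_neq (H : sgraph) (v w : H) : v -- w -> v != w.
Proof. by apply: contraTneq => ->; rewrite sedge_irrefl. Qed.

(** * Acyclic graphs *)

Section Acyclic.
Variable H : sgraph.
Implicit Types (u v w x : H) (p q : seq H).

(** Adjacency in H - v: for a tree-edge vw, [connect (avoid v) w] is the side of w, the component of
    H - v containing w. *)
Definition avoid v : rel H := fun a b => [&& a != v, b != v & a -- b].

Lemma connect_avoid_sym v : connect_sym (avoid v).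
Proof.
by apply: sym_connect_sym => a b; rewrite /avoid sedge_sym andbCA.
Qed.

Lemma path_avoid v w p :
  w != v -> path (avoid v) w p = (v \notin p) && path sedge w p.
Proof.
elim: p w => //= a p IHp w wv; rewrite /avoid wv inE negb_or [v == a]eq_sym.
have [//|av] := eqVneq a v.
by rewrite -/(avoid v) IHp //= andbCA.
Qed.

Lemma connect_avoid v w u :
  w != v ->
  reflect (exists2 p, path sedge w p /\ uniq [:: v, w & p] & last w p = u)
          (connect (avoid v) w u).
Proof.
move=> wv; apply: (iffP connectP) => [[p pp ->]|[p [pp /andP[vp _]] <-]].
  case/shortenP: pp => q pq uq _; exists q => //.
  move: pq; rewrite path_avoid // => /andP[vq pq]; split=> //.
  by rewrite cons_uniq uq inE negb_or eq_sym wv vq.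
exists p => //; rewrite path_avoid // pp andbT.
by move: vp; rewrite inE negb_or => /andP[].
Qed.

Lemma mem_path_avoid v w p u :
  path sedge v (w :: p) -> uniq [:: v, w & p] -> u \in w :: p ->
  connect (avoid v) w u.
Proof.
move=> /andP[vw wp] /andP[vp _]; move: vp; rewrite inE negb_or => /andP[wv vp].
by apply: path_connect; rewrite path_avoid ?vp // eq_sym.
Qed.

Lemma connect_avoid_neq v w u : w != v -> connect (avoid v) w u -> u != v.
Proof.
move=> wv /connectP[p]; rewrite path_avoid // => /andP[vp _] ->.
have := mem_last w p; rewrite inE => /orP[/eqP->//|].
by apply: contraTneq => ->.
Qed.

Hypothesis H_acyclic : acyclic H.

(** A simple path from w to w' off v closes through v to a cycle; acyclicity bounds its length by 2,
    so the path is trivial. *)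
Lemma connect_avoid_neighbours v w w' :
  v -- w -> v -- w' -> connect (avoid v) w w' -> w = w'.
Proof.
move=> vw vw'; have wv : w != v by rewrite eq_sym neighbour_neq.
case/(connect_avoid _ wv) => p [wp up] ew'.
suff: size [:: v, w & p] <= 2 by case: p ew' {wp up}.
apply: H_acyclic; rewrite /ucycle up andbT /= vw rcons_path wp ew' /=.
by rewrite sedge_sym.
Qed.

(** The first steps of both paths are neighbours of x connected off x through the common endpoint,
    hence equal; then induction. *)
Lemma simple_path_unique x p q :
  path sedge x p -> path sedge x q -> uniq (x :: p) -> uniq (x :: q) ->
  last x p = last x q -> p = q.
Proof.
elim: p x q => [|w p IHp] x [|w' q] //.
- by move=> _ _ _ /andP[xq _] /= e; case/negP: xq; rewrite {1}e mem_last.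
- by move=> _ _ /andP[xq _] _ /= e; case/negP: xq; rewrite -{1}e mem_last.
move=> xp xq up uq e.
have /andP[xw wp] := xp; have /andP[xw' wq] := xq.
have ww' : w = w'.
  apply: (connect_avoid_neighbours xw xw').
  apply: (connect_trans (mem_path_avoid xp up (mem_last _ _))).
  rewrite connect_avoid_sym; rewrite -[last w p]/(last x (w :: p)) e.
  exact: (mem_path_avoid xq uq (mem_last _ _)).
subst w'.
congr cons; apply: IHp wp wq _ _ e; first by case/andP: up.
by case/andP: uq.
Qed.

(** A vertex common to both branches would connect w to w' off v. *)
Lemma join_uniq v w w' p q :
  path sedge v (w :: p) -> path sedge v (w' :: q) ->
  uniq [:: v, w & p] -> uniq [:: v, w' & q] -> w != w' ->
  uniq (rev (w :: p) ++ [:: v, w' & q]).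
Proof.
move=> vp vq up uq ww'; rewrite cat_uniq rev_uniq uq andbT.
have := up; rewrite cons_uniq => /andP[vp' ->]; rewrite andTb.
apply/hasP => -[z]; rewrite inE mem_rev => /orP[/eqP->|zq zp]; first exact/negP.
case/eqP: ww'; have /andP[vw _] := vp; have /andP[vw' _] := vq.
apply: (connect_avoid_neighbours vw vw').
apply: (connect_trans (mem_path_avoid vp up zp)).
by rewrite connect_avoid_sym (mem_path_avoid vq uq).
Qed.

(** Sides are nested: a path from z off w cannot reach v, another neighbour of w, so putting w in
    front of it still avoids v. *)
Lemma avoid_step v w z u :
  v -- w -> w -- z -> z != v -> connect (avoid w) z u ->
  connect (avoid v) w u.
Proof.
move=> vw wz zv; have zw : z != w by rewrite eq_sym neighbour_neq.
case/(connect_avoid _ zw) => p [zp up] <-.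
have wp : path sedge w (z :: p) by rewrite /= wz.
have vzp : v \notin z :: p.
  apply/negP => /(mem_path_avoid wp up) /connect_avoid_neighbours e.
  by case/eqP: zv; apply: e => //; rewrite sedge_sym.
apply/connect_avoid; first by rewrite eq_sym neighbour_neq.
exists (z :: p) => //; split=> //; rewrite cons_uniq up andbT inE negb_or vzp.
by rewrite neighbour_neq.
Qed.

(** Two simple paths from v to u, one through w and one off w, would contradict uniqueness. *)
Lemma sides_disjoint v w u :
  v -- w -> connect (avoid v) w u -> connect (avoid w) v u -> False.
Proof.
move=> vw; have vDw := neighbour_neq vw; have wDv := vDw; rewrite eq_sym in wDv.
case/(connect_avoid _ wDv) => p [wp up] ep; case/(connect_avoid _ vDw) => q [vq uq] eq.
have qE : q = w :: p.
  apply: (@simple_path_unique v) => //=; rewrite ?vw ?eq //.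
  by case/andP: uq.
by move: uq; rewrite qE /= !inE eqxx orbT.
Qed.

(** Induction on the size of the side: if w is a node, it has a neighbour z other than v, whose side
    lies in that of w and omits w. *)
Lemma leaf_in_side v w : v -- w -> exists2 u, is_leaf u & connect (avoid v) w u.
Proof.
have [n] := ubnP #|connect (avoid v) w|; elim: n v w => // n IHn v w lt vw.
have [lw|nw] := boolP (is_leaf w); first by exists w.
have [z wz zv] := is_node_neighbour v nw.
have [|//|u lu cu] := IHn w z; last by exists u => //; apply: avoid_step cu.
rewrite -ltnS; apply: leq_trans lt; rewrite ltnS; apply: proper_card.
apply/properP; split; first by apply/subsetP => u; apply: avoid_step.
exists w; first exact: connect0.
apply/negP=> /connect_avoid_neq; rewrite eqxx; have := neighbour_neq wz.
by rewrite eq_sym => -> /(_ isT).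
Qed.

End Acyclic.

(** * Simple paths in connected graphs *)

Lemma simple_path_interior (H : sgraph) (a b c : H) (p : seq H) :
  path sedge a [:: b, c & p] -> uniq [:: a, b, c & p] -> is_node b.
Proof.
rewrite /= !inE !negb_or => /and3P[ab bc _] /and3P[/and3P[_ ac _] _ _].
by apply: (@is_nodeP _ b a c) => //; rewrite sedge_sym.
Qed.

Lemma tree_connect (H : sgraph) (x y : H) :
  connected_graph H -> connect sedge x y.
Proof.
case/andP => _ /forall_inP /(_ x (in_setT x)) /forall_inP /(_ y (in_setT y)).
by apply: connect_sub => a b /and3P[_ _ /connect1].
Qed.

Lemma connected_simple_path (H : sgraph) (x y : H) :
  connected_graph H ->
  exists p, [/\ path sedge x p, uniq (x :: p) & last x p = y].
Proof.
move=> /(tree_connect x y) /connectP[p xp ->].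
by case/shortenP: xp => q xq uq _; exists q.
Qed.

(** * Accessibility in graph-labelled trees *)

Section Accessible.
Variable T : glt.
Implicit Types (u v w x y : T) (p q s : seq T).

(** Computable form of the label condition in [accessible], to be evaluated on reversed and
    concatenated paths. *)
Fixpoint turns s : bool :=
  if s is a :: s1 then
    (if s1 is b :: s2 then if s2 is c :: _ then rho b a -- rho b c else true
     else true) && turns s1
  else true.

Lemma turnsP s :
  reflect (forall w v w', infix [:: w; v; w'] s -> rho v w -- rho v w') (turns s).
Proof.
elim: s => [|a s IHs]; first by left=> w v w'.
apply: (iffP andP) => [[ts /IHs h] w v w'|h].
  rewrite infix_consl => /orP[|/h//].
  by case: s ts {h IHs} => [|b [|c s]] //= ts; rewrite ?andbF // => /and4P[/eqP-> /eqP-> /eqP->].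
split; last by apply/IHs => w v w' i; apply: h; rewrite infix_consl i orbT.
by case: s h {IHs} => [|b [|c s]] // h; apply: h; rewrite infix_consl /= !eqxx prefix0s.
Qed.

Lemma turns_rev s : turns (rev s) = turns s.
Proof.
apply/turnsP/turnsP => h w v w' i; rewrite sedge_sym; apply: h.
  by rewrite -infix_rev revK.
by rewrite -infix_rev.
Qed.

(** Cutting a path at an interior vertex b loses only the turn at b. *)
Lemma turns_cat s a b c p :
  turns (s ++ [:: a, b, c & p]) =
  [&& turns (s ++ [:: a; b]), rho b a -- rho b c & turns [:: b, c & p]].
Proof.
elim: s => [|d s IHs]; first by [].
rewrite -[LHS]/(_ && turns (s ++ [:: a, b, c & p])) IHs.
rewrite -[turns ((d :: s) ++ [:: a; b])]/(_ && turns (s ++ [:: a; b])).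
by rewrite -andbA; congr (_ && _); case: s {IHs} => [|e [|f s]].
Qed.

(** Simple paths in a tree are unique, so any given one decides accessibility. *)
Lemma accessibleE x y p :
  path sedge x p -> uniq (x :: p) -> last x p = y -> y != x ->
  accessible x y <-> turns (x :: p).
Proof.
move=> xp up ep yx; split=> [[_ [q [xq uq eq h]]]|/turnsP h]; last first.
  by split=> //; exists p.
have -> : p = q.
  by apply: (simple_path_unique (proj2 (glt_is_tree T)) xp xq) => //; rewrite ep eq.
exact/turnsP.
Qed.

(* x is a leaf beyond the tree-edge vw, accessible from v. *)
Definition acc_leaf v w x : Prop :=
  is_leaf x /\
  exists p, [/\ path sedge v (w :: p), uniq [:: v, w & p], last w p = x &
                turns [:: v, w & p]].

Lemma acc_leaf_edge v w x : acc_leaf v w x -> v -- w.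
Proof. by case=> _ [p [/andP[]]]. Qed.

Lemma acc_leaf_leaf v w : is_leaf w -> v -- w -> acc_leaf v w w.
Proof.
move=> lw vw; split=> //; exists [::]; split=> //=; first by rewrite vw.
by rewrite inE neighbour_neq.
Qed.

(** The path from x to y is one branch reversed, then v, then the other branch; all turns except the
    one at v hold already. *)
Lemma acc_leaf_join v w w' x y :
  w != w' -> acc_leaf v w x -> acc_leaf v w' y ->
  x != y /\ (accessible x y <-> rho v w -- rho v w').
Proof.
move=> ww' [_ [p [vp up ep tp]]] [_ [q [vq uq eq tq]]].
have acycT := proj2 (glt_is_tree T).
have uj := join_uniq acycT vp vq up uq ww'.
pose s := rev (belast v (w :: p)) ++ w' :: q.
have sE : x :: s = rev (w :: p) ++ [:: v, w' & q].
  by rewrite [in RHS]lastI rev_rcons ep /s /= rev_cons cat_rcons.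
have xs : path sedge x s.
  rewrite cat_path /s {1 2}[belast v _]/= rev_cons last_rcons vq andbT -rev_cons.
  rewrite -ep -[last w p]/(last v (w :: p)) -[v :: _]/(belast v (w :: p)) rev_path.
  by rewrite -(eq_path (e := sedge)) // => a b; apply: sedge_sym.
have us : uniq (x :: s) by rewrite sE.
have ls : last x s = y by rewrite last_cat.
have yx : y != x.
  have /andP[xs' _] := us; apply: contraNneq xs' => <-.
  by rewrite mem_cat -eq mem_last orbT.
split; first by rewrite eq_sym.
suff <- : turns (x :: s) = (rho v w -- rho v w') by exact: accessibleE.
rewrite sE rev_cons cat_rcons turns_cat tq andbT.
have -> : rev p ++ [:: w; v] = rev [:: v, w & p] by rewrite !rev_cons -!cats1 -catA.
by rewrite turns_rev tp.
Qed.

Lemma acc_leaf_extend v u w x :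
  v -- u -> v != w -> rho u v -- rho u w -> acc_leaf u w x -> acc_leaf v u x.
Proof.
move=> vu vw r [lx [p [up uq ep tp]]]; split=> //; exists (w :: p); split=> //.
- by rewrite /= vu.
- rewrite cons_uniq uq andbT inE negb_or neighbour_neq //=.
  apply/negP => /(mem_path_avoid up uq).
  have uw : u -- w by case/andP: up.
  move/(connect_avoid_neighbours (proj2 (glt_is_tree T)) uw) => e.
  by case/eqP: vw; rewrite e // sedge_sym.
- by rewrite -[turns _]/((rho u v -- rho u w) && _) r.
Qed.

Variables (G : sgraph) (f : G -> T).
Hypothesis G_connected : connected_graph G.
Hypothesis f_leaf : leaf_bijection f.
Hypothesis f_acc : forall x y : G, x -- y <-> accessible (f x) (f y).

Lemma leaf_codom v : is_leaf v -> exists x : G, v = f x.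
Proof. by rewrite (proj2 f_leaf) => /codomP. Qed.

Lemma codom_leaf (x : G) : is_leaf (f x).
Proof. by rewrite (proj2 f_leaf) codom_f. Qed.

(* As G is connected, it has an edge between the two sides of vw. *)
Lemma acc_leaf_exists v w :
  v -- w ->
  exists2 x : G, acc_leaf v w (f x) &
    is_node v -> exists2 w', v -- w' & rho v w -- rho v w'.
Proof.
move=> vw; have acycT := proj2 (glt_is_tree T).
have wv : w != v by rewrite eq_sym neighbour_neq.
have [_ /leaf_codom[x0 ->] c0] := leaf_in_side acycT vw.
have wEv : w -- v by rewrite sedge_sym.
have [_ /leaf_codom[y0 ->] d0] := leaf_in_side acycT wEv.
pose A := [set x | connect (avoid v) w (f x)].
have yA : y0 \notin A by rewrite inE; apply/negP => /(sides_disjoint acycT vw); apply.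
(* A walk in [G] from [x0] to [y0] leaves [A] along some edge. *)
have [x [y [xA {}yA xy]]] : exists x y : G, [/\ x \in A, y \notin A & x -- y].
  have /connectP[p xp yE] := tree_connect x0 y0 G_connected.
  have : x0 \in A by rewrite inE.
  elim: p {c0} x0 xp yE => [|z p IHp] x0 /=; first by move=> _ e xA; case/negP: yA; rewrite e.
  case/andP=> xz zp e xA; have [zA|zA] := boolP (z \in A); first exact: IHp zA.
  by exists x0, z.
have [_ [s [xs us es /turnsP ts]]] := (proj1 (f_acc x y)) xy.
rewrite !inE in xA yA.
have fxv := connect_avoid_neq wv xA.
(* The path witnessing the edge leaves the side of w, so it visits v, coming from w; its initial
   part reversed is the required branch. *)
have vs : v \in s.
  apply/negPn/negP => vs; case/negP: yA; apply: connect_trans xA _.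
  by rewrite -es; apply/connectP; exists s; rewrite // path_avoid // vs.
case/splitPr: vs xs us es ts => s1 s2.
rewrite cat_path -cat_cons; case/andP=> xs1 /andP[lv vs2] us es ts.
pose w1 := last (f x) s1.
have w1w : w = w1.
  apply: (connect_avoid_neighbours acycT vw); first by rewrite sedge_sym.
  apply: connect_trans xA _; apply/connectP; exists s1 => //.
  rewrite path_avoid // xs1 andbT.
  by move: us; rewrite -cat_rcons cat_uniq rcons_uniq inE negb_or; case/andP => /andP[/andP[]].
exists x.
  split; first exact: codom_leaf.
  exists (rev (belast (f x) s1)).
  have sE : rev (rcons (f x :: s1) v) = [:: v, w & rev (belast (f x) s1)].
    by rewrite rev_rcons [f x :: s1]lastI rev_rcons w1w.
  split.
  - rewrite w1w /= sedge_sym lv rev_path /=.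
    by rewrite -(eq_path (e := sedge)) // => a b; apply: sedge_sym.
  - by rewrite -sE rev_uniq; move: us; rewrite -cat_rcons cat_uniq => /andP[].
  - by rewrite w1w /w1; case: s1 {xs1 lv us es ts w1 w1w sE} => //= a s1; rewrite rev_cons last_rcons.
  - rewrite -sE turns_rev; apply/turnsP => a b c i; apply: (elimT (turnsP _) ts).
    by rewrite -cat_rcons infix_catr.
(* A node v is not the final leaf [f y], so the path continues past v to some [w']. *)
move=> nv; case: s2 vs2 us es ts => [|w' s2] vs2 us es ts.
  by move: nv; rewrite last_cat /= in es; rewrite /is_node es codom_leaf.
exists w'; first by case/andP: vs2.
rewrite w1w; apply: (elimT (turnsP _) ts); apply/infixP.
by exists (belast (f x) s1), s2; rewrite /w1 /= -[in RHS]cat_rcons -lastI.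
Qed.

Lemma edge_acc_leaf v w w' (x y : G) :
  w != w' -> acc_leaf v w (f x) -> acc_leaf v w' (f y) ->
  x != y /\ x -- y = (rho v w -- rho v w').
Proof.
move=> ww' ax ay; have [xy e] := acc_leaf_join ww' ax ay; split.
  by apply: contra_neq xy => ->.
by apply/idP/idP => [/f_acc /e|/e /f_acc].
Qed.

End Accessible.

(** * Blow-ups of acyclic graphs *)

Definition blow_up (G C : sgraph) (pi : G -> C) : Prop :=
  forall x y : G, x -- y = (x != y) && ((pi x == pi y) || (pi x -- pi y)).

Section BlowUp.
Variables (G C : sgraph) (pi : G -> C).
Hypothesis C_acyclic : acyclic C.
Hypothesis pi_blow_up : blow_up pi.
Implicit Types x y z a b : G.

Lemma blow_up_adj x y : x -- y -> pi x != pi y -> pi x -- pi y.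
Proof. by rewrite pi_blow_up => /andP[_ /orP[->|]]. Qed.

(** Vertices with the same image are true twins, so a third vertex adjacent to only one of them
    separates their images. *)
Lemma blow_up_distinguished x y a :
  a != x -> a != y -> (x -- a) != (y -- a) -> pi x != pi y.
Proof.
rewrite ![a == _]eq_sym !pi_blow_up => -> ->.
by apply: contraNneq => ->.
Qed.

Lemma blow_up_nonadjacent x y : x != y -> ~~ (x -- y) -> pi x != pi y.
Proof. by rewrite pi_blow_up => ->; rewrite negb_or => /andP[]. Qed.

Lemma blow_up_triangle x y z :
  x -- y -> y -- z -> z -- x ->
  pi x != pi y -> pi y != pi z -> pi z != pi x -> False.
Proof.
move=> xy yz zx dxy dyz dzx.
suff: size [:: pi x; pi y; pi z] <= 2 by [].
apply: C_acyclic; rewrite /ucycle /= !inE negb_or dxy dyz [pi x == _]eq_sym dzx.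
by rewrite !blow_up_adj.
Qed.

Lemma blow_up_square x y a b :
  x != y -> a != b -> x -- a -> x -- b -> y -- a -> y -- b ->
  ~~ (x -- y) -> ~~ (a -- b) -> False.
Proof.
move=> xy ab xa xb ya yb nxy nab.
have dxy := blow_up_nonadjacent xy nxy.
have dab := blow_up_nonadjacent ab nab.
(* The endpoints of each side of the square are separated by a vertex adjacent to just one of them,
   so the four images are distinct and form a 4-cycle. *)
have dist u v w : w != u -> u -- v -> v -- w -> ~~ (u -- w) -> pi u != pi v.
  move=> wu uv vw uw; apply: (@blow_up_distinguished _ _ w) => //.
    by rewrite eq_sym neighbour_neq.
  by rewrite vw (negbTE uw).
have dxa : pi x != pi a by apply: (dist _ _ y); rewrite // ?(eq_sym y) // sedge_sym.
have dxb : pi x != pi b by apply: (dist _ _ y); rewrite // ?(eq_sym y) // sedge_sym.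
have nyx : ~~ (y -- x) by rewrite sedge_sym.
have dya : pi y != pi a by apply: (dist _ _ x) => //; rewrite sedge_sym.
have dyb : pi y != pi b by apply: (dist _ _ x) => //; rewrite sedge_sym.
suff: size [:: pi x; pi a; pi y; pi b] <= 2 by [].
apply: C_acyclic; rewrite /ucycle /= !inE !negb_or dxy dxa dxb dyb dab /=.
rewrite [pi a == _]eq_sym dya !blow_up_adj //= 1?eq_sym // sedge_sym //.
Qed.

End BlowUp.

Lemma blow_up_comp (G H C : sgraph) (g : H -> G) (pi : G -> C) :
  injective g -> (forall m n : H, m -- n = (g m -- g n)) ->
  blow_up pi -> blow_up (pi \o g).
Proof. by move=> gI gE pib m n; rewrite gE pib (inj_eq gI). Qed.

Lemma acyclic_leaf (H : sgraph) (x : H) : acyclic H -> exists y : H, is_leaf y.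
Proof.
move=> acycH; have [lx|nx] := boolP (is_leaf x); first by exists x.
have [w xw _] := is_node_neighbour x nx.
by have [y] := leaf_in_side acycH xw; exists y.
Qed.

(** With four vertices or more, a pair of twins would be one part of a split. Without twins, H
    embeds in C and is acyclic, and then a leaf together with its neighbour is one part of a
    split. *)
Lemma prime_blow_up (H C : sgraph) (pi : H -> C) :
  acyclic C -> blow_up pi -> is_prime H -> #|H| <= 3.
Proof.
move=> acycC pib /forallP prH; rewrite leqNgt; apply/negP => H4.
(* Both parts have at least two vertices, so only the adjacency condition of a split remains. *)
have pair (x y : H) : x != y ->
    (forall a b, a \in [set x; y] -> b \notin [set x; y] ->
       (exists2 b', b' \notin [set x; y] & a -- b') ->
       (exists2 a', a' \in [set x; y] & a' -- b) -> a -- b) -> False.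
  move=> xy h; case/negP: (prH [set x; y]); apply/and3P; split.
  - by rewrite cards2 xy.
  - by have := cardsC [set x; y]; rewrite cards2 xy -(leq_add2l 2) => ->.
  - apply/forall_inP => a aS; apply/forall_inP => b; rewrite in_setC => bS.
    apply/implyP => /andP[/exists_inP[b' b'S ab'] /exists_inP[a' a'S a'b]].
    by apply: (h a b aS bS); [exists b'; rewrite -?in_setC | exists a'].
have piI : injective pi.
  move=> x y exy; apply/eqP/negPn/negP => xy; apply: (pair x y xy).
  move=> a b; rewrite !inE negb_or => aS /andP[bx byy] _ [a']; rewrite !inE => a'S.
  have piE c : (c == x) || (c == y) -> pi c = pi x by case/orP => /eqP->.
  rewrite !pib (piE a') // (piE a) // => /andP[_ ->]; rewrite andbT.
  by case/orP: aS => /eqP->; rewrite eq_sym.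
have edgeE (x y : H) : x -- y = pi x -- pi y.
  rewrite pib (inj_eq piI); case: eqVneq => //= ->.
  by rewrite sedge_irrefl.
have acycH : acyclic H.
  move=> s /andP[cs us]; rewrite -(size_map pi); apply: acycC.
  rewrite /ucycle map_inj_uniq // us andbT.
  case: s cs {us} => //= a s; rewrite -map_rcons path_map.
  by rewrite (eq_path (e' := sedge)) // => u v /=; rewrite edgeE.
have [x0 _] : exists x0 : H, true by case/card_gt0P: (ltnW (ltnW (ltnW H4))) => x0; exists x0.
have [x lx] := acyclic_leaf x0 acycH.
(* If x is isolated, y is any other vertex. In either case only y can have neighbours outside the
   pair. *)
have [y yx xy] : exists2 y, y != x & forall z, x -- z -> z = y.
  have [y /= xy|no] := pickP [pred y | x -- y].
    exists y; first by rewrite eq_sym neighbour_neq.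
    by move=> z xz; apply: (is_leaf_neighbour lx).
  have /card_gt0P[y] : 0 < #|predC1 x|.
    by rewrite -(ltn_add2l 1) -[X in _ < X + _](card1 x) cardC addn0 ltnW // ltnW.
  by rewrite !inE => yx; exists y => // z xz; have := no z; rewrite /= xz.
apply: (pair x y); first by rewrite eq_sym.
move=> a b; rewrite !inE negb_or => aS /andP[bx byy] [b'].
rewrite !inE negb_or => /andP[b'x b'y] ab' [a']; rewrite !inE => a'S a'b.
have yE c d : (c == x) || (c == y) -> d != y -> c -- d -> c = y.
  by case/orP => /eqP-> // dy /xy de; rewrite de eqxx in dy.
by rewrite (yE a b') // -(yE a' b).
Qed.

(** * Distances and 3-leaf powers *)

(** Simple paths have length below [#|H|], so the search defining [dist] succeeds and finds the
    least length of a walk. *)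
Lemma dist_leqP (H : sgraph) (x y : H) (k : nat) :
  connected_graph H ->
  reflect (exists p, [/\ path sedge x p, last x p = y & size p <= k])
          (dist x y <= k).
Proof.
move=> connH; rewrite /dist.
set a := (fun n : nat => _); set s := iota 0 _.
have walkP n : reflect (exists p, [/\ path sedge x p, last x p = y & size p = n]) (a n).
  apply: (iffP existsP) => [[p /andP[xp /eqP ep]]|[p [xp ep /eqP sp]]].
    by exists p; rewrite size_tuple.
  by exists (Tuple sp); rewrite /= xp ep eqxx.
have short p : path sedge x p -> uniq (x :: p) -> size p < #|H|.
  by move=> _ /card_uniqP e; rewrite -[_.+1]/(size (x :: p)) -e max_card.
have has_a : has a s.
  have [p [xp up ep]] := connected_simple_path x y connH.
  apply/hasP; exists (size p); last by apply/walkP; exists p.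
  by rewrite mem_iota add0n short.
apply: (iffP idP) => [le_k|[p [xp ep sp]]].
  have := nth_find 0 has_a; rewrite nth_iota ?add0n => [/walkP[p [xp ep sp]]|].
    by exists p; rewrite sp.
  by rewrite -[X in _ < X](size_iota 0) -has_find.
move: ep; case/shortenP: xp => q xq uq sub_qp ep.
have sq : size q <= k.
  by apply: leq_trans sp; apply: uniq_leq_size => [|z /sub_qp//]; case/andP: uq.
apply: leq_trans sq; rewrite leqNgt; apply/negP => lt.
have := before_find 0 lt; rewrite nth_iota ?add0n ?short // => /walkP; apply.
by exists q.
Qed.

Lemma leaf_power3_blow_up (G : sgraph) :
  leaf_power 3 G -> exists (C : sgraph) (pi : G -> C), acyclic C /\ blow_up pi.
Proof.
case=> T [f [[connT acycT] [f_inj f_leaf] f_dist]].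
(* The default [f x] is taken only if [f x] has no neighbour; [pi_adj] excludes this once G has two
   vertices. *)
pose pi x := odflt (f x) [pick w | f x -- w].
have piE x w : f x -- w -> w = pi x.
  move=> xw; rewrite /pi; case: pickP => [z xz|/(_ w)]; last by rewrite xw.
  by apply: is_leaf_neighbour xw xz; rewrite f_leaf codom_f.
have pi_adj x y : x != y -> f x -- pi x.
  move=> xy; have [[|w p] [/=]] := connected_simple_path (f x) (f y) connT.
    by move=> _ _ /f_inj e; rewrite e eqxx in xy.
  by case/andP=> xw _ _ _; rewrite -(piE x w).
exists T, pi; split=> // x y; case: eqVneq => [->|xy]; first by rewrite sedge_irrefl.
rewrite f_dist //; have xx := pi_adj x y xy.
have yy : f y -- pi y by apply: (pi_adj y x); rewrite eq_sym.
have yy' : pi y -- f y by rewrite sedge_sym.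
apply/(dist_leqP _ _ _ connT)/orP => [[p [xp ep sp]]|[/eqP e|e]].
(* Length 0 is excluded. Length 1 means two adjacent leaves, each the image of the other; length 2
   gives equal images and length 3 adjacent ones. *)
- case: p xp ep sp => [|a [|b [|c [|d p]]]] //=.
  + by move=> _ /f_inj e; rewrite e eqxx in xy.
  + case/andP=> xa _ e _; right; rewrite -(piE x a xa) e.
    by rewrite e in xa; rewrite -(piE y (f x)) // sedge_sym.
  + case/and3P=> xa ab _ e _; left; apply/eqP; rewrite -(piE x a xa).
    by apply: piE; rewrite -e sedge_sym.
  + case/and4P=> xa ab bc _ e _; right; rewrite -(piE x a xa) -(piE y b) //.
    by rewrite -e sedge_sym.
- by exists [:: pi x; f y]; split; rewrite //= xx e yy'.
- by exists [:: pi x; pi y; f y]; split; rewrite //= xx e yy'.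
Qed.

(** * Stars, and graphs on three vertices *)

(** Three vertices make the centre unique; in the two-vertex star both vertices are universal. *)
Lemma star_centre (H : sgraph) :
  is_star H -> 3 <= #|H| ->
  exists c : H, (forall x : H, is_centre x = (x == c)) /\
    (forall x y : H, x -- y = (x != y) && (is_centre x || is_centre y)).
Proof.
move=> st H3; have /andP[_ /existsP[c /forallP hc]] := st.
have adjE (x y : H) : x -- y = (x != y) && ((x == c) || (y == c)).
  by have /forallP/(_ y)/eqP := hc x.
exists c; suff cE (x : H) : is_centre x = (x == c).
  by split=> // x y; rewrite !cE.
rewrite /is_centre st /=; apply/forallP/eqP => [h|-> y]; last first.
  by apply/implyP => yc; rewrite adjE eqxx eq_sym yc.
apply/eqP/negPn/negP => xc.
have : 0 < #|~: [set x; c]|.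
  by have := cardsC [set x; c]; rewrite cards2 xc -(ltn_add2l 2) => ->.
case/card_gt0P => y; rewrite !inE negb_or => /andP[yx yc].
by have := h y; rewrite yx /= adjE (negbTE xc) (negbTE yc) andbF.
Qed.

Lemma star_not_clique (H : sgraph) : is_star H -> 3 <= #|H| -> ~~ is_clique H.
Proof.
move=> st H3; have [c [cE adjE]] := star_centre st H3.
apply/negP => /forallP cl.
have : 1 < #|~: [set c]|.
  by have := cardsC [set c]; rewrite cards1 -(ltn_add2l 1) => ->.
case/card_gt1P => x [y []]; rewrite !inE => xc yc xy.
have /forallP/(_ y) := cl x; rewrite xy /= adjE !cE.
by rewrite (negbTE xc) (negbTE yc) andbF.
Qed.

(** If a and b are not adjacent, the third vertex c is the only possible neighbour of each, hence
    the centre of a star. *)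
Lemma card3_clique_or_star (H : sgraph) :
  #|H| = 3 -> (forall x : H, exists y, x -- y) -> is_clique H || is_star H.
Proof.
move=> H3 nbr; case: (boolP (is_clique H)) => //= /forallPn[a /forallPn[b]].
rewrite negb_imply => /andP[ab nab].
have cab : #|~: [set a; b]| = 1.
  by apply/eqP; have := cardsC [set a; b]; rewrite cards2 ab H3 -(eqn_add2l 2) => ->.
have /cards1P[c cE] : #|~: [set a; b]| == 1 by rewrite cab.
have cC (x : H) : [|| x == a, x == b | x == c].
  by have := in_setC x [set a; b]; rewrite cE !inE => ->; case: (x == a); case: (x == b).
have [ca cb] : c != a /\ c != b.
  by apply/andP; rewrite -negb_or; have := in_setC c [set a; b]; rewrite cE !inE eqxx.
have ac : a -- c.
  have [y ay] := nbr a; have := cC y; case/or3P => /eqP e; rewrite e in ay => //.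
    by rewrite sedge_irrefl in ay.
  by rewrite ay in nab.
have bc : b -- c.
  have [y ay] := nbr b; have := cC y; case/or3P => /eqP e; rewrite e in ay => //.
    by rewrite sedge_sym ay in nab.
  by rewrite sedge_irrefl in ay.
have nba : b -- a = false by rewrite sedge_sym; apply: negbTE.
rewrite /is_star H3; apply/existsP; exists c.
apply/forallP => x; apply/forallP => y; apply/eqP.
have [cEa cEb acE bcE baE] : [/\ (c == a) = false, (c == b) = false, (a == c) = false,
   (b == c) = false & (b == a) = false].
  by rewrite ![_ == c]eq_sym [b == a]eq_sym !(negbTE ca, negbTE cb, negbTE ab).
have /or3P[] := cC x => /eqP->; have /or3P[] := cC y => /eqP->;
  rewrite ?sedge_irrefl ?eqxx ?cEa ?cEb ?acE ?bcE ?(negbTE ab) ?baE ?ac ?bc ?nba ?(negbTE nab) //.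
- by rewrite sedge_sym ac.
- by rewrite sedge_sym bc.
Qed.

(** * The split tree of a blow-up *)

Section SplitTree.
Variables (G : sgraph) (T : glt) (f : G -> T).
Hypothesis G_connected : connected_graph G.
Hypothesis T_reduced : reduced T.
Hypothesis f_leaf : leaf_bijection f.
Hypothesis f_acc : forall x y : G, x -- y <-> accessible (f x) (f y).
Implicit Types (u v w : T).

Lemma label_card v : is_node v -> 3 <= #|glt_label v|.
Proof.
case: T_reduced => /(_ v) deg3 _ _ nv; apply: leq_trans (deg3 nv) _.
by rewrite /degree -(card_in_image (@rho_inj T v nv)) max_card.
Qed.

Lemma star_node_centre u :
  star_node u -> exists c : glt_label u, (forall x, is_centre x = (x == c)) /\
    (forall x y : glt_label u, x -- y = (x != y) && (is_centre x || is_centre y)).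
Proof. by case/andP => nu st; apply: star_centre st (label_card nu). Qed.

Lemma star_node_not_clique u : star_node u -> ~~ clique_node u.
Proof.
case/andP=> nu st; apply/negP => /andP[_]; apply/negP.
exact: star_not_clique st (label_card nu).
Qed.

Lemma rho_eq v w w' :
  is_node v -> v -- w -> v -- w' -> (rho v w == rho v w') = (w == w').
Proof. by move=> nv vw vw'; apply/eqP/eqP => [|->//]; apply: rho_inj. Qed.

Lemma third_edge v w w' :
  is_node v -> exists z, [/\ v -- z, z != w & z != w'].
Proof.
case: T_reduced => /(_ v) deg3 _ _ /deg3 d3.
have /card_gt0P[z] : 0 < #|[set z | v -- z] :\: [set w; w']|.
  rewrite cardsD subn_gt0; apply: leq_trans (_ : 3 <= _); last by rewrite cardsE.
  apply: leq_ltn_trans (subset_leq_card (subsetIr _ _)) _.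
  by rewrite cards2; case: (_ != _).
by rewrite !inE negb_or => /andP[/andP[? ?] ?]; exists z.
Qed.

Lemma centre_edge u :
  star_node u -> exists2 w, u -- w & is_centre (rho u w).
Proof.
move=> su; have [c [cE _]] := star_node_centre su.
have [w uw wc] := rho_surj (proj1 (andP su)) c.
by exists w; rewrite // cE wc.
Qed.

Lemma star_adj u w w' :
  star_node u -> u -- w -> u -- w' ->
  rho u w -- rho u w' = (w != w') && (is_centre (rho u w) || is_centre (rho u w')).
Proof.
move=> su uw uw'; have [c [_ ->]] := star_node_centre su.
by rewrite rho_eq //; case/andP: su.
Qed.

Lemma star_centre_unique u w w' :
  star_node u -> u -- w -> u -- w' -> is_centre (rho u w) -> is_centre (rho u w') ->
  w = w'.
Proof.
move=> su uw uw'; have [c [cE _]] := star_node_centre su; rewrite !cE => /eqP e1 /eqP e2.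
by apply/eqP; rewrite -(@rho_eq u) ?e1 ?e2 //; case/andP: su.
Qed.

Lemma extremity_edge u w :
  star_node u -> exists w', [/\ u -- w', w' != w & ~~ is_centre (rho u w')].
Proof.
move=> su; have [c uc cc] := centre_edge su.
have [w' [uw' w'w w'c]] := third_edge w c (proj1 (andP su)).
exists w'; split=> //; apply: contra w'c => cw'.
by rewrite (star_centre_unique su uw' uc).
Qed.

Lemma clique_adj v w w' :
  clique_node v -> v -- w -> v -- w' -> w != w' -> rho v w -- rho v w'.
Proof.
case/andP=> nv /forallP/(_ (rho v w))/forallP/(_ (rho v w'))/implyP cl vw vw' ww'.
by apply: cl; rewrite rho_eq.
Qed.

(** Each marker vertex is sent to an accessible leaf beyond its tree-edge; adjacency of such leaves
    is decided at v alone. *)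
Lemma label_embedding v :
  is_node v ->
  exists g : glt_label v -> G,
    injective g /\ forall m n : glt_label v, m -- n = (g m -- g n).
Proof.
move=> nv.
have ex (m : glt_label v) : exists gw : G * T,
    acc_leaf v gw.2 (f gw.1) /\ rho v gw.2 = m.
  have [w vw wm] := rho_surj nv m.
  by have [x ax _] := acc_leaf_exists G_connected f_leaf f_acc vw; exists (x, w).
have [g gP] := fin_all_exists ex; exists (fun m => (g m).1).
have gneq m n : m != n -> (g m).1 != (g n).1 /\
    ((g m).1 -- (g n).1) = (m -- n).
  have [am em] := gP m; have [an en] := gP n => mn.
  have wn : (g m).2 != (g n).2 by apply: contraNneq mn => e; rewrite -em -en e.
  by have := edge_acc_leaf f_acc wn am an; rewrite em en.
split=> [m n e|m n].
  by apply/eqP/negPn/negP => /gneq[]; rewrite e eqxx.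
by case: (eqVneq m n) => [->|/gneq[]//]; rewrite !sedge_irrefl.
Qed.

(** * Structure forced on the split tree by a blow-up *)

Section BlowUpSplitTree.
Variables (C : sgraph) (pi : G -> C).
Hypothesis C_acyclic : acyclic C.
Hypothesis pi_blow_up : blow_up pi.

(** A prime label embeds in G, hence has exactly three vertices; none is isolated, since accessible
    paths continue through every node. *)
Lemma blow_up_clique_star :
  (forall v, is_node v -> is_prime (glt_label v) \/ is_degenerate (glt_label v)) ->
  clique_star_tree T.
Proof.
move=> pd v nv; have [pr|//] := pd v nv.
have [g [g_inj gE]] := label_embedding nv.
have le3 := prime_blow_up C_acyclic (blow_up_comp g_inj gE pi_blow_up) pr.
apply: card3_clique_or_star => [|m]; first by apply/eqP; rewrite eqn_leq le3 label_card.
have [w vw <-] := rho_surj nv m.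
have [_ _ /(_ nv)[w' _ r]] := acc_leaf_exists G_connected f_leaf f_acc vw.
by exists (rho v w').
Qed.

(** The leaves a and b are taken beyond two extremities of u. They serve as half of an induced
    4-cycle and as separating vertices. *)
Lemma leaves_beyond_centre u w :
  star_node u -> u -- w -> is_centre (rho u w) ->
  exists a b : G,
    [/\ a != b, ~~ (a -- b), acc_leaf w u (f a), acc_leaf w u (f b) &
        forall t : G, acc_leaf u w (f t) ->
          [/\ t != a, t != b, t -- a & t -- b]].
Proof.
move=> su uw wc; have wu : w -- u by rewrite sedge_sym.
have [w1 [uw1 w1w w1c]] := extremity_edge w su.
have [w2 [uw2 w2w1 w2w]] := third_edge w1 w (proj1 (andP su)).
have w2c : ~~ is_centre (rho u w2).
  by apply: contra w2w => c2; rewrite (star_centre_unique su uw2 uw).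
rewrite eq_sym in w1w; rewrite eq_sym in w2w; rewrite eq_sym in w2w1.
have r1 : rho u w -- rho u w1 by rewrite star_adj // w1w wc.
have r2 : rho u w -- rho u w2 by rewrite star_adj // w2w wc.
have [a aa _] := acc_leaf_exists G_connected f_leaf f_acc uw1.
have [b ab _] := acc_leaf_exists G_connected f_leaf f_acc uw2.
have [dab eab] := edge_acc_leaf f_acc w2w1 aa ab; exists a, b; split=> //.
- by rewrite eab star_adj // (negbTE w1c) (negbTE w2c) andbF.
- exact: acc_leaf_extend aa.
- exact: acc_leaf_extend ab.
- move=> t at_; have [? ->] := edge_acc_leaf f_acc w1w at_ aa.
  by have [? ->] := edge_acc_leaf f_acc w2w at_ ab.
Qed.

(** If uw is at the centre of u, then a and b lie beyond two extremities, and b is adjacent to t but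
    not to a. Otherwise a lies beyond the centre and b beyond another extremity, and b is adjacent
    to a but not to t. *)
Lemma star_distinguishes u w :
  star_node u -> w -- u ->
  exists2 a : G, acc_leaf w u (f a) &
    forall t : G, acc_leaf u w (f t) -> pi a != pi t.
Proof.
move=> su wu; have uw : u -- w by rewrite sedge_sym.
have leafx v := @acc_leaf_exists T G f G_connected f_leaf f_acc u v.
have [wc|wc] := boolP (is_centre (rho u w)).
- have [a [b [dab nab aa ab h]]] := leaves_beyond_centre su uw wc.
  exists a => // t /h[ta tb _ etb].
  by apply: (blow_up_distinguished pi_blow_up (a := b)); rewrite 1?eq_sym // etb.
- have [w1 uw1 w1c] := centre_edge su.
  have w1w : w1 != w by apply: contraNneq wc => <-.
  have [w2 [uw2 w2w nc2]] := extremity_edge w su.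
  have w12 : w1 != w2 by apply: contraNneq nc2 => <-.
  have [a aa _] := leafx _ uw1; have [b ab _] := leafx _ uw2.
  exists a.
    by apply: acc_leaf_extend aa; rewrite 1?eq_sym ?star_adj // 1?eq_sym ?w1w ?w1c ?orbT.
  move=> t at_; have [dab eab] := edge_acc_leaf f_acc w12 aa ab.
  have ww2 : w != w2 by rewrite eq_sym.
  have [dtb etb] := edge_acc_leaf f_acc ww2 at_ ab.
  apply: (blow_up_distinguished pi_blow_up (a := b)); rewrite 1?eq_sym // eab etb.
  by rewrite !star_adj // w12 ww2 (negbTE wc) (negbTE nc2) w1c.
Qed.

(** Leaves beyond u, v and a third neighbour of w form a triangle; u separates the image of the
    first from the other two, and v separates those two. *)
Lemma blow_up_no_star_clique_star u w v :
  star_node u -> clique_node w -> star_node v -> w -- u -> w -- v -> u != v -> False.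
Proof.
move=> su cw sv wu wv uv; have [nw _] := andP cw.
have [z [wz zu zv]] := third_edge u v nw.
have [uz vz] : u != z /\ v != z by rewrite ![_ == z]eq_sym.
have [a aa da] := star_distinguishes su wu.
have [b ab db] := star_distinguishes sv wv.
have [c ac _] := acc_leaf_exists G_connected f_leaf f_acc wz.
have ext s t x : w -- s -> w -- t -> s != t -> acc_leaf w t (f x) -> acc_leaf s w (f x).
  by move=> ws wt st; apply: acc_leaf_extend => //; [rewrite sedge_sym | exact: clique_adj].
have [_ eab] := edge_acc_leaf f_acc uv aa ab.
have [_ ebc] := edge_acc_leaf f_acc vz ab ac.
have [_ eca] := edge_acc_leaf f_acc zu ac aa.
apply: (blow_up_triangle C_acyclic pi_blow_up (x := a) (y := b) (z := c)).
- by rewrite eab clique_adj.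
- by rewrite ebc clique_adj.
- by rewrite eca clique_adj.
- by apply: da; apply: ext ab.
- by apply: db; apply: ext ac.
- by rewrite eq_sym; apply: da; apply: ext ac.
Qed.

(** Two nonadjacent leaves beyond each of the two centres form an induced 4-cycle. *)
Lemma blow_up_no_facing_centres u v :
  star_node u -> star_node v -> u -- v ->
  is_centre (rho u v) -> is_centre (rho v u) -> False.
Proof.
move=> su sv uv cu cv; have vu : v -- u by rewrite sedge_sym.
have [a [b [dab nab aa ab h]]] := leaves_beyond_centre su uv cu.
have [c [d [dcd ncd ac ad _]]] := leaves_beyond_centre sv vu cv.
have [_ _ ca cb] := h c ac; have [_ _ da db] := h d ad.
by apply: (blow_up_square C_acyclic pi_blow_up dcd dab ca cb da db).
Qed.

Lemma blow_up_conditions :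
  (forall v, is_node v -> is_prime (glt_label v) \/ is_degenerate (glt_label v)) ->
  [/\ clique_star_tree T, star_nodes_connected T & centres_towards_leaf_or_clique T].
Proof.
move=> pd; have cs := blow_up_clique_star pd.
have nodeE v : is_node v -> clique_node v || star_node v.
  by move=> nv; have := cs v nv; rewrite /clique_node /star_node nv.
split=> //.
- apply/forall_inP => u; rewrite inE => su; apply/forall_inP => v; rewrite inE => sv.
  have [p [up uq ev]] := connected_simple_path u v (proj1 (glt_is_tree T)).
  rewrite -ev in sv * => {v ev}.
  elim: p u up uq sv su => [|w p IHp] u up uq sv su; first exact: connect0.
  have [uw wp] := andP up; have [_ uq'] := andP uq.
  (* Were w a clique node, its successor on the path would be a clique node, against reducedness, or
     a star node, giving the forbidden star-clique-star pattern. *)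
  suff sw : star_node w.
    by apply: connect_trans (IHp w wp uq' sv sw); apply: connect1; rewrite /= !inE su sw.
  case: p {IHp} up uq sv wp uq' => [//|w2 p] up uq sv wp uq'.
  have nw := simple_path_interior up uq.
  have [/andP[ww2 _] wu] : (w -- w2) && path sedge w2 p /\ w -- u by rewrite [w -- u]sedge_sym.
  have nw2 : is_node w2.
    case: p sv wp uq' {up uq} => [/andP[]//|z p] _; exact: simple_path_interior.
  have uw2 : u != w2 by move: uq; rewrite /= !inE !negb_or => /andP[/and3P[]].
  have [cw|//] := orP (nodeE w nw); have [cw2|sw2] := orP (nodeE w2 nw2).
    by case: T_reduced => _ /(_ _ _ ww2); rewrite cw cw2.
  by case: (blow_up_no_star_clique_star su cw sw2 wu ww2 uw2).
- move=> u w su uw cw; have [lw|nw] := boolP (is_leaf w); [by left|right].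
  have /orP[//|sw] := nodeE w nw; have [_ st] := andP sw.
  (* Reducedness turns a centre facing a star node into two facing centres. *)
  case: T_reduced => _ _ /(_ _ _ uw su sw); rewrite cw /is_extremity st /= negbK => cwu.
  by case: (blow_up_no_facing_centres su sw uw cw cwu).
Qed.

End BlowUpSplitTree.
End SplitTree.

(** The root is [G] itself, whose only vertex counts as a leaf. *)
Lemma single_vertex_leaf_power (G : sgraph) (k : nat) :
  connected_graph G -> #|G| <= 1 -> leaf_power k G.
Proof.
move=> connG /card_le1_eqP G1.
have eqG (x y : G) : x = y by apply: G1.
exists G, id; split.
- split=> // s /andP[_ /card_uniqP <-].
  by apply: leqW; apply/card_le1_eqP => x y _ _; apply: eqG.
- split=> // v; rewrite (codom_f id v) /is_leaf /degree.
  by apply/card_le1_eqP => x y _ _; apply: eqG.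
- by move=> x y; rewrite (eqG x y) eqxx.
Qed.

(** * The 3-leaf root of a blow-up *)

Section LeafRoot.
Variables (G C : sgraph) (pi : G -> C).
Hypothesis C_acyclic : acyclic C.
Hypothesis pi_blow_up : blow_up pi.
Hypothesis G_connected : connected_graph G.

(** The root is C cut down to the image of [pi], with a pendant leaf at [pi x] for each x. The
    restriction makes it connected and leaves no vertex of C without a pendant leaf. *)
Definition root_edge : rel (G + {c : C | c \in codom pi}) := fun a b =>
  match a, b with
  | inl x, inr c | inr c, inl x => pi x == val c
  | inr c, inr d => val c -- val d
  | inl _, inl _ => false
  end.

Lemma root_edge_sym : symmetric root_edge.
Proof. by move=> [x|c] [y|d] //=; apply: sedge_sym. Qed.

Lemma root_edge_irrefl : irreflexive root_edge.
Proof. by move=> [x|c] //=; apply: sedge_irrefl. Qed.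

Definition root := SGraph root_edge_sym root_edge_irrefl.

Definition root_leaf (x : G) : root := inl x.
Definition root_pi (x : G) : root := inr (Sub (pi x) (codom_f pi x)).

Lemma root_leaf_edge x (b : root) : (root_leaf x -- b) = (b == root_pi x).
Proof. by case: b => //= c; rewrite eq_sym. Qed.

Lemma root_pi_edge x y : (root_pi x -- root_pi y) = (pi x -- pi y).
Proof. by []. Qed.

Lemma root_pi_eq x y : (root_pi x == root_pi y) = (pi x == pi y).
Proof. by []. Qed.

Lemma root_vertex (a : root) : exists x, a = root_leaf x \/ a = root_pi x.
Proof.
case: a => [x|[c cP]]; first by exists x; left.
have [x e] := codomP cP; exists x; right.
by congr inr; apply: val_inj.
Qed.

Lemma root_leaf_pi x : root_leaf x -- root_pi x.
Proof. by rewrite root_leaf_edge. Qed.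

Lemma root_connected : connected_graph root.
Proof.
have symR : connect_sym (sedge (s := root)) by apply/sym_connect_sym/sedge_sym.
have leaf_pi x : connect sedge (root_leaf x) (root_pi x) by apply/connect1/root_leaf_pi.
have pis x y : connect sedge (root_pi x) (root_pi y).
  have /connectP[p xp ->] := tree_connect x y G_connected.
  elim: p x xp => [|z p IHp] x /=; first by rewrite connect0.
  case/andP=> xz /IHp; apply: connect_trans.
  have := xz; rewrite pi_blow_up => /andP[_ /orP[e|e]].
    by apply: eq_connect0; apply/eqP; rewrite root_pi_eq.
  exact/connect1.
have conn (a b : root) : connect sedge a b.
  have [x ax] := root_vertex a; have [y bY] := root_vertex b.
  apply: (@connect_trans _ _ (root_pi x)).
    by case: ax => ->; rewrite ?connect0.
  apply: (connect_trans (pis x y)).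
  by case: bY => ->; rewrite ?connect0 // symR.
have /card_gt0P[x _] := proj1 (andP G_connected).
apply/andP; split; first by apply/card_gt0P; exists (root_leaf x).
apply/forall_inP => a _; apply/forall_inP => b _.
apply: etrans (conn a b); apply: eq_connect => c d /=.
by rewrite !in_setT.
Qed.

Lemma root_acyclic : acyclic root.
Proof.
move=> s /andP[cs us]; rewrite leqNgt; apply/negP => s3.
(* Both neighbours of a pendant leaf on a cycle would be [root_pi x], so the whole cycle lies in
   C. *)
have no_leaf x : root_leaf x \notin s.
  apply/negP => /rot_to[i t e].
  have := s3; rewrite -(size_rot i) e; move: cs us.
  rewrite -(rot_cycle i) -(rot_uniq i) e.
  case: t {e} => [|a [|b t]] // ct ut _.
  have xa : root_leaf x -- a by case/andP: ct.
  have lx : last b t -- root_leaf x.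
    by have := ct; rewrite /cycle rcons_path => /andP[_].
  rewrite sedge_sym root_leaf_edge in lx; rewrite root_leaf_edge in xa.
  have /and3P[_ /negP ab _] := ut; case: ab.
  by rewrite (eqP xa) -(eqP lx) /= mem_last.
pose g (a : root) : C := match a with inl x => pi x | inr c => val c end.
have inner a : a \in s -> exists x, a = root_pi x.
  by move=> sa; have [x [e|e]] := root_vertex a; [case/negP: (no_leaf x); rewrite -e | exists x].
suff: size (map g s) <= 2 by rewrite size_map leqNgt s3.
apply: C_acyclic; rewrite /ucycle map_inj_in_uniq ?us ?andbT; last first.
  by move=> a b /inner[x ->] /inner[y ->] /= e; apply/eqP; rewrite root_pi_eq e.
rewrite cycle_map; apply: sub_in_cycle (allss s) cs.
by move=> a b /inner[x ->] /inner[y ->].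
Qed.

(** A neighbour z of x in G gives [root_pi x] a second neighbour: the leaf of z if the images agree,
    the image of z otherwise. For a single vertex the root would be one edge, with two leaves. *)
Lemma root_is_leaf (a : root) : 1 < #|G| -> is_leaf a = (a \in codom root_leaf).
Proof.
move=> G2; have [x [->|->]] := root_vertex a.
  rewrite codom_f /is_leaf /degree (eq_card (B := pred1 (root_pi x))) ?card1 // => b.
  by rewrite !inE root_leaf_edge.
transitivity false; last by apply/esym/negP => /codomP[].
have xpi : root_pi x -- root_leaf x by rewrite sedge_sym root_leaf_pi.
have [y yx] : exists y, y != x.
  by case/card_gt1P: G2 => y [z [_ _ yz]]; case: (eqVneq y x) yz => [->|]; [exists z; rewrite eq_sym | exists y].
have [p [xp _ ep]] := connected_simple_path x y G_connected.
case: p xp ep => [|z p] /=; first by move=> _ e; rewrite e eqxx in yx.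
case/andP => xz _ _; apply/negbTE.
have [e|ne] := eqVneq (pi x) (pi z).
  apply: (is_nodeP xpi (b := root_leaf z)); first by rewrite /= e.
  by apply: contraTneq xz => -[->]; rewrite sedge_irrefl.
apply: (is_nodeP xpi (b := root_pi z)) => //.
by rewrite root_pi_edge (blow_up_adj pi_blow_up xz ne).
Qed.

Lemma root_dist x y : x != y -> x -- y = (dist (root_leaf x) (root_leaf y) <= 3).
Proof.
move=> xy; have e x' y' : x' -- y' -> y' -- x' by rewrite sedge_sym.
rewrite pi_blow_up xy; apply/idP/(dist_leqP _ _ _ root_connected) => [/orP[/eqP exy|xyE]|].
- exists [:: root_pi x; root_leaf y]; split=> //=.
  by rewrite eqxx exy eqxx.
- by exists [:: root_pi x; root_pi y; root_leaf y]; split=> //=; rewrite !eqxx xyE.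
case=> -[|a [|b [|c [|d p]]]] [] //.
- by move=> _ [exy]; rewrite exy eqxx in xy.
- by case/andP; rewrite root_leaf_edge => /eqP-> _.
- case/and3P; rewrite root_leaf_edge => /eqP-> xb _ eb _.
  by rewrite [last _ _]/= in eb; rewrite eb /= in xb; rewrite eq_sym xb.
- case/and4P; rewrite root_leaf_edge => /eqP-> xb bc _ ec _.
  rewrite [last _ _]/= in ec; rewrite ec sedge_sym root_leaf_edge in bc.
  by rewrite (eqP bc) root_pi_edge in xb; rewrite xb orbT.
Qed.

End LeafRoot.

Lemma blow_up_leaf_power3 (G C : sgraph) (pi : G -> C) :
  acyclic C -> blow_up pi -> connected_graph G -> leaf_power 3 G.
Proof.
move=> acycC pib connG; have [G1|G2] := leqP #|G| 1; first exact: single_vertex_leaf_power.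
exists (root pi), (root_leaf pi); split.
- by split; [apply: root_connected | apply: root_acyclic].
- by split=> [x y []|a] //; apply: (root_is_leaf pib).
- by move=> x y; apply: root_dist.
Qed.

(** * From the split tree to a blow-up *)

Lemma acc_leaf_inv (T : glt) (v u x : T) :
  acc_leaf v u x -> is_node u ->
  exists w, [/\ v != w, rho u v -- rho u w & acc_leaf u w x].
Proof.
move=> [lx [p [vp up ep tp]]] nu; case: p vp up ep tp => [|w p] vp up ep tp.
  by move: nu; rewrite -[u]/(last u [::]) ep /is_node lx.
exists w; split.
- by move: up; rewrite /= !inE !negb_or => /andP[/and3P[]].
- by case/andP: tp.
- split=> //; exists p; split=> //; first by case/andP: vp.
  + by case/andP: up.
  + by case/andP: tp.
Qed.

Lemma acc_leaf_eq (T : glt) (v w x : T) : acc_leaf v w x -> is_leaf w -> x = w.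
Proof.
case=> lx [p [vp up <- _]] lw; case: p vp up => [|z p] // vp up.
by have := simple_path_interior vp up; rewrite /is_node lw.
Qed.

Lemma accessible_first (T : glt) (x y w : T) :
  is_leaf x -> is_leaf y -> x -- w -> accessible x y -> acc_leaf x w y.
Proof.
move=> lx ly xw [yx [[|w' p] [xp up ep /turnsP tp]]].
  by move: yx; rewrite -ep eqxx.
have e : w' = w by apply: is_leaf_neighbour lx _ xw; case/andP: xp.
by rewrite e in xp up ep tp; split=> //; exists p.
Qed.

Section ReducedTree.
Variables (G : sgraph) (T : glt) (f : G -> T).
Hypothesis G_connected : connected_graph G.
Hypothesis T_reduced : reduced T.
Hypothesis f_leaf : leaf_bijection f.
Hypothesis f_acc : forall x y : G, x -- y <-> accessible (f x) (f y).
Hypothesis T_clique_star : clique_star_tree T.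
Hypothesis T_stars : star_nodes_connected T.
Hypothesis T_centres : centres_towards_leaf_or_clique T.
Implicit Types (u v w x y : T).

Let T_acyclic : acyclic T := proj2 (glt_is_tree T).
Let T_connected : connected_graph T := proj1 (glt_is_tree T).

Lemma node_clique_or_star v : is_node v -> clique_node v || star_node v.
Proof.
by move=> nv; have := T_clique_star nv; rewrite /clique_node /star_node nv.
Qed.

Lemma clique_not_star v : clique_node v -> ~~ star_node v.
Proof. by apply: contraL; apply: star_node_not_clique. Qed.

Lemma star_star_extremity u v :
  star_node u -> star_node v -> u -- v -> ~~ is_centre (rho u v).
Proof.
move=> su sv uv; apply/negP => /(T_centres su uv)[lv|cv].
  by case/andP: sv; rewrite /is_node lv.
by have := star_node_not_clique T_reduced sv; rewrite cv.
Qed.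

(** Star nodes are joined by paths of star nodes, which avoid the clique node w; so neighbours u and
    u' are connected off w. *)
Lemma clique_star_unique w u u' :
  clique_node w -> star_node u -> star_node u' -> w -- u -> w -- u' -> u = u'.
Proof.
move=> cw su su' wu wu'; apply: (connect_avoid_neighbours T_acyclic wu wu').
have /forall_inP/(_ u) := T_stars; rewrite inE => /(_ su) /forall_inP/(_ u').
rewrite inE => /(_ su'); apply: connect_sub => a b /=; rewrite !inE.
case/and3P=> sa sb ab; apply: connect1; rewrite /avoid ab andbT.
by apply/andP; split; apply: contraTneq (clique_not_star cw) => <-; rewrite ?sa ?sb.
Qed.

(* The leaf x belongs to the clique of leaves that the edge uw hangs on u. *)
Definition attached x u w : Prop :=
  [/\ is_leaf x, star_node u, u -- w & w = x \/ clique_node w /\ w -- x].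

Lemma attached_not_star x u w : attached x u w -> ~~ star_node w.
Proof.
case=> lx _ _ [->|[/clique_not_star//]].
by rewrite /star_node /is_node lx.
Qed.

Lemma attached_star_unique x u w v :
  attached x u w -> star_node v -> v -- w -> v = u.
Proof.
case=> lx su uw [e|[cw _]] sv vw.
  by rewrite e in uw vw; apply: (is_leaf_neighbour lx); rewrite sedge_sym.
by apply: (clique_star_unique cw); rewrite // sedge_sym.
Qed.

Lemma attached_acc_leaf x u w : attached x u w -> acc_leaf u w x.
Proof.
move=> a; have nw := attached_not_star a; case: a => lx su uw [e|[cw wx]].
  by rewrite e in uw *; apply: acc_leaf_leaf.
have ux : u != x by apply: contraTneq su => ->; rewrite /star_node /is_node lx.
apply: acc_leaf_extend (acc_leaf_leaf lx wx) => //.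
by apply: clique_adj => //; rewrite sedge_sym.
Qed.

(** If w is a clique node, the next vertex on the path is neither a clique node, by reducedness, nor
    a star node, as u is the only one adjacent to w; so it is the leaf y. *)
Lemma acc_leaf_attached y u w :
  star_node u -> ~~ star_node w -> acc_leaf u w y -> attached y u w.
Proof.
move=> su sw ay; have uw := acc_leaf_edge ay; have [ly _] := ay; split=> //.
have [lw|nw] := boolP (is_leaf w); first by left; rewrite (acc_leaf_eq ay lw).
have cw : clique_node w by have := node_clique_or_star nw; rewrite (negbTE sw) orbF.
have [z [uz _ az]] := acc_leaf_inv ay nw; have wz := acc_leaf_edge az.
have [lz|nz] := boolP (is_leaf z); first by right; rewrite (acc_leaf_eq az lz).
have [cz|sz] := orP (node_clique_or_star nz).
  by case: T_reduced => _ /(_ _ _ wz); rewrite cw cz.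
by case/eqP: uz; apply: (clique_star_unique cw) => //; rewrite sedge_sym.
Qed.

(** On the path from x to s the first node is a star node, or a clique node followed by a star
    node. *)
Lemma attached_exists x (s : T) : is_leaf x -> star_node s -> exists u w, attached x u w.
Proof.
move=> lx ss; have [p [xp up ep]] := connected_simple_path x s T_connected.
have ns := proj1 (andP ss).
case: p xp up ep => [|w p] xp up ep; first by rewrite -ep /is_node lx in ns.
have xw : x -- w by case/andP: xp.
have wx : w -- x by rewrite sedge_sym.
have nw : is_node w.
  by case: p ep xp up => [/= -> //|z p _]; apply: simple_path_interior.
have [cw|sw] := orP (node_clique_or_star nw); last first.
  by exists w, x; split=> //; left.
case: p ep xp up => [e|z p ep xp up].
  by have := clique_not_star cw; rewrite [w](e : w = s) ss.
have wz : w -- z by case/and3P: xp.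
have nz : is_node z.
  case: p ep xp up => [/= -> //|t p _ /andP[_ h] /andP[_ h']].
  exact: simple_path_interior h h'.
have [cz|sz] := orP (node_clique_or_star nz).
  by case: T_reduced => _ /(_ _ _ wz); rewrite cw cz.
by exists z, w; split; rewrite // 1?sedge_sym //; right.
Qed.

(** All nodes are clique nodes and no two are adjacent, so a path between leaves has at most one
    interior vertex. *)
Lemma no_star_clique (x y : G) :
  (forall v : T, ~~ star_node v) -> x -- y = (x != y).
Proof.
move=> ns; case: eqVneq => [->|xy]; first by rewrite sedge_irrefl.
apply/f_acc.
have [p [xp up ep]] := connected_simple_path (f x) (f y) T_connected.
have yx : f y != f x by rewrite (inj_eq (proj1 f_leaf)) eq_sym.
apply/(accessibleE xp up ep yx).
have cl v : is_node v -> clique_node v.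
  by move=> /node_clique_or_star; rewrite (negbTE (ns v)) orbF.
case: p xp up ep => [|a [|b [|c p]]] // xp up _.
  rewrite /= !andbT; have ca := cl _ (simple_path_interior xp up).
  have /and3P[xa ab _] := xp; apply: clique_adj => //; first by rewrite sedge_sym.
  by move: up; rewrite /= !inE !negb_or => /andP[/andP[]].
have ca := cl _ (simple_path_interior xp up).
have /andP[_ xp'] := xp; have /andP[_ up'] := up.
have cb := cl _ (simple_path_interior xp' up').
have /andP[ab _] := xp'.
by case: T_reduced => _ /(_ _ _ ab); rewrite ca cb.
Qed.

(** * The blow-up map into the split tree *)

Section Attachment.
Variables (U W : G -> T).
Hypothesis UW : forall x : G, attached (f x) (U x) (W x).

Definition quotient (x : G) : T := if is_centre (rho (U x) (W x)) then U x else W x.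

Lemma attached_unique x u w u' w' :
  attached x u w -> attached x u' w' -> u = u' /\ w = w'.
Proof.
move=> [lx su uw [e|[cw wx]]] [_ su' uw' [e'|[cw' wx']]].
- split; last by rewrite e e'.
  by rewrite e in uw; rewrite e' in uw'; apply: (is_leaf_neighbour lx); rewrite sedge_sym.
- have e2 : u = w'.
    by rewrite e in uw; apply: (is_leaf_neighbour lx); rewrite sedge_sym.
  by have := clique_not_star cw'; rewrite -e2 su.
- have e2 : u' = w.
    by rewrite e' in uw'; apply: (is_leaf_neighbour lx); rewrite sedge_sym.
  by have := clique_not_star cw; rewrite -e2 su'.
- have e : w = w' by apply: (is_leaf_neighbour lx); rewrite sedge_sym.
  split=> //; rewrite -e in uw'; apply: (clique_star_unique cw) => //.
  all: by rewrite sedge_sym.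
Qed.

Lemma same_bag_edge (x y : G) : x != y -> U x = U y -> W x = W y -> x -- y.
Proof.
move=> xy eU eW; have := UW x; have := UW y; rewrite -eU -eW.
move=> [ly su uw hy] [lx _ _ hx].
have fxy : f x != f y by rewrite (inj_eq (proj1 f_leaf)).
have nlW z : clique_node (W x) -> is_leaf z -> W x = z -> False.
  by move=> /andP[nW _] lz e; rewrite /is_node e lz in nW.
case: hx hy => [ex|[cw wx]] [ey|[cw' wy]].
- by case/eqP: fxy; rewrite -ex ey.
- by case: (nlW _ cw' lx ex).
- by case: (nlW _ cw ly ey).
- have [_ ->] := edge_acc_leaf f_acc fxy (acc_leaf_leaf lx wx) (acc_leaf_leaf ly wy).
  exact: clique_adj.
Qed.

Lemma same_star_edge (x y : G) :
  U x = U y -> W x != W y ->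
  x -- y = (is_centre (rho (U x) (W x)) || is_centre (rho (U y) (W y))).
Proof.
move=> eU nW; have := UW y; rewrite -eU => ay; have ax := UW x.
have [_ ->] := edge_acc_leaf f_acc nW (attached_acc_leaf ax) (attached_acc_leaf ay).
have [_ su uw _] := ax; have [_ _ uw' _] := ay.
by rewrite star_adj // nW.
Qed.

Lemma adjacent_stars_edge (x y : G) :
  U x -- U y -> is_centre (rho (U x) (W x)) -> is_centre (rho (U y) (W y)) -> x -- y.
Proof.
move=> uv cx cy; have ax := UW x; have ay := UW y.
have [_ su uw _] := ax; have [_ sv vw _] := ay; have vu : U y -- U x by rewrite sedge_sym.
have uw' : U x != W y by apply: contraTneq su => ->; apply: attached_not_star ay.
have wv : W x != U y by apply: contraTneq sv => <-; apply: attached_not_star ax.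
have ay' : acc_leaf (U x) (U y) (f y).
  apply: acc_leaf_extend (attached_acc_leaf ay) => //.
  by rewrite star_adj // uw' cy orbT.
have [_ ->] := edge_acc_leaf f_acc wv (attached_acc_leaf ax) ay'.
by rewrite star_adj // wv cx.
Qed.

(** An accessible path meets at most two star nodes: edges between star nodes are at extremities on
    both ends, so the second one is left through its centre, towards a leaf or a clique node. *)
Lemma edge_cases (x y : G) :
  x -- y ->
  (U x = U y /\ W x = W y) \/ (U x = U y /\ W x != W y) \/
  [/\ U x -- U y, is_centre (rho (U x) (W x)) & is_centre (rho (U y) (W y))].
Proof.
move=> xy; have ax := UW x; have [lx su uw hx] := ax; have [ly _ _ _] := UW y.
(* The path has turned at [U x] from [W x] to n; either y is attached at n, or n is the second star
   node [U y]. *)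
have beyond n : W x != n -> rho (U x) (W x) -- rho (U x) n -> acc_leaf (U x) n (f y) ->
    (U x = U y /\ W x != W y) \/
  [/\ U x -- U y, is_centre (rho (U x) (W x)) & is_centre (rho (U y) (W y))].
  move=> wn r an; have un := acc_leaf_edge an.
  have [sn|sn] := boolP (star_node n); last first.
    have [eU eW] := attached_unique (UW y) (acc_leaf_attached su sn an).
    by left; rewrite eU eW.
  have [m [um r' am]] := acc_leaf_inv an (proj1 (andP sn)).
  have nm := acc_leaf_edge am; have nu : n -- U x by rewrite sedge_sym.
  have cm : is_centre (rho n m).
    move: r'; rewrite star_adj // um.
    by rewrite (negbTE (star_star_extremity sn su nu)).
  have sm : ~~ star_node m.
    by apply: contraL cm => sm; apply: star_star_extremity.
  have [eU eW] := attached_unique (UW y) (acc_leaf_attached sn sm am).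
  right; rewrite eU eW; split=> //.
  move: r; rewrite star_adj // wn (negbTE (star_star_extremity su sn un)).
  by rewrite orbF.
(* Either x hangs directly on [U x], or the path enters the clique node [W x] and goes on to a leaf
   of the same clique or to [U x]. *)
have acc := proj1 (f_acc x y) xy; case: hx => [e|[cw wx]].
  have xu : f x -- U x by rewrite -e sedge_sym.
  have [n [xn r an]] := acc_leaf_inv (accessible_first lx ly xu acc) (proj1 (andP su)).
  by right; apply: (beyond n); rewrite ?e.
have xw : f x -- W x by rewrite sedge_sym.
have [n [xn _ an]] := acc_leaf_inv (accessible_first lx ly xw acc) (proj1 (andP cw)).
have wn := acc_leaf_edge an; have wu : W x -- U x by rewrite sedge_sym.
have [ln|nn] := boolP (is_leaf n).
  have [-> ->] : U y = U x /\ W y = W x; last by left.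
  apply: attached_unique (UW y) _; split=> //; right; split=> //.
  by rewrite (acc_leaf_eq an ln).
have [cn|sn] := orP (node_clique_or_star nn).
  by case: T_reduced => _ /(_ _ _ wn); rewrite cw cn.
have en := clique_star_unique cw sn su wn wu; rewrite {}en in xn an wn sn nn.
by have [m [wm r am]] := acc_leaf_inv an nn; right; apply: (beyond m).
Qed.

Lemma quotient_blow_up : blow_up quotient.
Proof.
(* An edge between the images [U x] and [W y] forces [U x] to be the unique star node next to [W y],
   that is [U y]. *)
have ctr_ext (x y : G) : is_centre (rho (U x) (W x)) -> ~~ is_centre (rho (U y) (W y)) ->
    U x -- W y -> x -- y.
  move=> cx cy uw; have ax := UW x; have [_ su uwx _] := ax.
  have ay := UW y.
  have eU : U x = U y by apply: (attached_star_unique ay).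
  have nW : W x != W y by apply: contraNneq cy => <-; rewrite -eU.
  by rewrite same_star_edge // cx.
move=> x y; case: (eqVneq x y) => [->|xy]; first by rewrite sedge_irrefl.
have [lx su uw hx] := UW x; have [ly sv vw hy] := UW y.
apply/idP/orP => [exy|].
  have [[eU eW]|[[eU nW]|[uv cx cy]]] := edge_cases exy; rewrite /quotient.
  - by left; rewrite eU eW.
  - right; move: exy; rewrite same_star_edge //.
    have [cx _|_ /= ->] := boolP (is_centre (rho (U x) (W x))); last first.
      by rewrite sedge_sym -eU.
    have /negbTE-> : ~~ is_centre (rho (U y) (W y)); last by rewrite eU.
    apply: contra nW => cy; apply/eqP.
    by rewrite -eU in cy vw; apply: (star_centre_unique T_reduced su).
  - by right; rewrite cx cy.
rewrite /quotient; have [cx|cx] := boolP (is_centre (rho (U x) (W x)));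
  have [cy|cy] := boolP (is_centre (rho (U y) (W y))).
- case=> [/eqP eU|uv]; last exact: adjacent_stars_edge.
  apply: same_bag_edge => //; rewrite -eU in cy vw *.
  exact: (star_centre_unique T_reduced su).
- case=> [/eqP e|]; last exact: ctr_ext.
  by have := attached_not_star (UW y); rewrite -e su.
- case=> [/eqP e|wu]; first by have := attached_not_star (UW x); rewrite e sv.
  by rewrite sedge_sym; apply: ctr_ext => //; rewrite sedge_sym.
(* Images [W x] and [W y] are never adjacent: a leaf would be adjacent only to its star node, and
   two clique nodes contradict reducedness. *)
- case=> [/eqP e|ww].
    by apply: same_bag_edge => //; apply: (attached_star_unique (UW y)); rewrite -?e.
  case: hx => [ex|[cx' _]].
    have e : U x = W y.
      by rewrite ex in uw ww; apply: (is_leaf_neighbour lx); rewrite // sedge_sym.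
    by have := attached_not_star (UW y); rewrite -e su.
  case: hy => [ey|[cy' _]].
    have e : U y = W x.
      by rewrite ey in vw ww; apply: (is_leaf_neighbour ly); rewrite // sedge_sym.
    by have := attached_not_star (UW x); rewrite -e sv.
  by case: T_reduced => _ /(_ _ _ ww); rewrite cx' cy'.
Qed.

End Attachment.

Lemma conditions_blow_up : exists pi : G -> T, blow_up pi.
Proof.
have [s ss|ns] := pickP (@star_node T); last first.
  (* Without star nodes G is complete, and a constant map is a blow-up. *)
  have /card_gt0P[t _] := proj1 (andP T_connected).
  exists (fun=> t) => x y; rewrite eqxx andbT.
  by apply: no_star_clique => v; rewrite ns.
have ex (x : G) : exists uw : T * T, attached (f x) uw.1 uw.2.
  by have [u [w a]] := attached_exists (codom_leaf f_leaf x) ss; exists (u, w).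
have [g gP] := fin_all_exists ex.
by exists (quotient (fun x : G => (g x).1) (fun x : G => (g x).2)); apply: quotient_blow_up.
Qed.

End ReducedTree.

Theorem mainTheorem6 (G : sgraph) (G_connected : connected_graph G)
    (ST : glt) (ST_split_tree : is_split_tree G ST) :
  leaf_power 3 G <->
  [/\ clique_star_tree ST,
      star_nodes_connected ST &
      centres_towards_leaf_or_clique ST].
Proof.
case: ST_split_tree => redST pdST [f [f_leaf f_acc]]; split=> [|[cs sc ctr]].
  by case/leaf_power3_blow_up => C [pi [acycC pib]]; apply: (blow_up_conditions G_connected redST f_leaf f_acc acycC pib pdST).
have [pi pib] := conditions_blow_up redST f_leaf f_acc cs sc ctr.
exact: blow_up_leaf_power3 (proj2 (glt_is_tree ST)) pib G_connected.
Qed.
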